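(* Let $M>0$. On the set of probability distributions $\nu$ on $\{-\infty\}\cup\mathbb{R}$ such that $\nu([-\infty,M])=1$ and $\nu(\{M\})>0$, the time constant $\nu\mapsto C(\nu)$ is strictly increasing for the stochastic order. That is, if $\nu_1\neq\nu_2$ belong to this set and $\nu_1$ is stochastically dominated by $\nu_2$, then $C(\nu_1)<C(\nu_2)$.
   Context: The space $\{-\infty\}\cup\mathbb{R}$ carries its usual topology and Borel $\sigma$-algebra. For a probability distribution $\nu$ on $\{-\infty\}\cup\mathbb{R}$, let $(X_{i,j})_{0\le i<j}$ be i.i.d. random variables with distribution $\nu$, where $X_{i,j}$ is the weight of the directed edge $(i,j)$ of the complete directed acyclic graph on the non-negative integers. A directed path is a sequence of integers $\pi=(i_1,\dots,i_k)$ with $0\le i_1<\dots<i_k$; its weight is $w_\pi=X_{i_1,i_2}+\dots+X_{i_{k-1},i_k}$. Let $W_n=\max\{w_\pi : \pi=(i_1,\dots,i_k) \text{ a directed path with } i_1=0,\ i_k=n\}$. Then $W_n/n$ converges almost surely to a deterministic constant $C(\nu)\in\mathbb{R}\cup\{\pm\infty\}$, called the time constant for last passage percolation. Stochastic order: $\nu_1$ is stochastically dominated by $\nu_2$ if $\nu_1([-\infty,t])\ge\nu_2([-\infty,t])$ for all $t\in\mathbb{R}$. *)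

(* Defs.v *)
From HB Require Import structures.
From mathcomp Require Import all_boot all_order all_algebra finmap.
From mathcomp Require Import all_classical all_reals all_analysis.
From mathcomp Require Import measurable_realfun.

Set Implicit Arguments.
Unset Strict Implicit.
Unset Printing Implicit Defensive.

Import Order.TTheory GRing.Theory Num.Theory.
Import numFieldNormedType.Exports.

Local Open Scope classical_set_scope.
Local Open Scope ring_scope.

(* A probability distribution on {-oo} U R is a [probability (\bar R) R] giving
   no mass to +oo. *)

(* A measure is a function on all sets, with arbitrary values outside the
   sigma-algebra, so Leibniz equality of the records is too fine. *)
Definition same_distribution (R : realType) (nu1 nu2 : probability (\bar R) R) :
    Prop :=
  forall A : set (\bar R), measurable A -> nu1 A = nu2 A.

Definition stochastically_dominated (R : realType)
    (nu1 nu2 : probability (\bar R) R) : Prop :=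
  forall t : R,
    (nu2 [set x | (x <= t%:E)%E] <= nu1 [set x | (x <= t%:E)%E])%E.

(* Only the weights X i j with i < j are constrained; the other values of X
   never occur in the weight of a directed path. *)
Definition iid_weights (R : realType) (nu : probability (\bar R) R)
    (d : measure_display) (T : measurableType d) (P : probability T R)
    (X : nat -> nat -> T -> \bar R) : Prop :=
  [/\ forall i j : nat, (i < j)%N -> measurable_fun [set: T] (X i j),
      forall i j : nat, (i < j)%N ->
        forall B : set (\bar R), measurable B -> P (X i j @^-1` B) = nu B
    & forall (E : {fset nat * nat}) (B : nat * nat -> set (\bar R)),
        (forall e, e \in E -> (e.1 < e.2)%N) ->
        (forall e, e \in E -> measurable (B e)) ->
        P (\bigcap_(e in [set` E]) (X e.1 e.2 @^-1` B e)) =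
        (\prod_(e <- E) P (X e.1 e.2 @^-1` B e))%E].

Definition directed_path (m n : nat) (p : seq nat) : Prop :=
  exists s : seq nat, [/\ p = m :: s, path ltn m s & last m s = n].

Definition path_weight (R : realType) (x : nat -> nat -> \bar R)
    (p : seq nat) : \bar R :=
  (\sum_(e <- zip p (behead p)) x e.1 e.2)%E.

(* The set of directed paths from 0 to n is finite and nonempty, so the
   supremum is a maximum. *)
Definition last_passage (R : realType) (x : nat -> nat -> \bar R) (n : nat) :
    \bar R :=
  ereal_sup [set path_weight x p | p in directed_path 0 n].

(* The law of the family X, hence the almost sure limit, depends only on nu:
   at most one c satisfies this, whichever probability space carries X. *)
Definition is_time_constant (R : realType) (nu : probability (\bar R) R)
    (c : \bar R) : Prop :=
  exists (d : measure_display) (T : measurableType d) (P : probability T R)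
         (X : nat -> nat -> T -> \bar R),
    iid_weights nu P X /\
    {ae P, forall w : T,
      (fun n : nat => (last_passage (fun i j => X i j w) n * (n%:R^-1)%:E)%E)
        @ \oo --> c}.

(* Main.v *)
(* Couple the two families edge by edge through the quantile functions of
   nu1 and nu2 applied to independent uniform variables: X1 <= X2 <= M, the edges
   with X1 = M have positive probability, and so do those with X1 <= t and
   t + delta <= X2, for suitable t and delta > 0. Call a window of consecutive
   vertices good when all edges between its two halves are of the latter kind,
   the short edges inside each half weigh M, and every vertex before (after) the
   window is linked by edges of weight M to its left (right) half. Every path
   jumps over the middle of the window. If the jump stays in the window it gains
   delta when X1 is replaced by X2; otherwise the jump, worth at most M, can be
   replaced by a detour through the window worth at least M + delta. So each
   good window raises max(W_n, 0) by delta. By independence and a union bound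
   over a geometric series, a window is good with probability bounded below, so
   the mean of W_n / n truncated to [0, M] grows by a fixed positive amount, and
   bounded convergence gives the strict inequality between the truncations of C1
   and C2, hence between C1 and C2. *)
Require Import Defs.
From HB Require Import structures.
From mathcomp Require Import all_boot all_order all_algebra.
From mathcomp Require Import finmap.
From mathcomp Require Import all_classical all_reals all_analysis.
From mathcomp Require Import measurable_realfun.
From mathcomp Require Import zify ring lra.

Set Implicit Arguments.
Unset Strict Implicit.
Unset Printing Implicit Defensive.

Import Order.TTheory GRing.Theory Num.Theory.
Import numFieldNormedType.Exports.

Local Open Scope classical_set_scope.
Local Open Scope ring_scope.

(** * Paths and good windows *)

Section Paths.
Context {R : realType}.
Implicit Types (x y z : nat -> nat -> \bar R) (s : seq nat) (w : \bar R).

Lemma path_weight1 x u : path_weight x [:: u] = 0%E.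
Proof. by rewrite /path_weight /= big_nil. Qed.

Lemma path_weight_cons x u v s :
  path_weight x [:: u, v & s] = (x u v + path_weight x (v :: s))%E.
Proof. by rewrite /path_weight /= big_cons. Qed.

Lemma path_weight_cat x u s1 s2 :
  path_weight x (u :: s1 ++ s2) =
  (path_weight x (u :: s1) + path_weight x (last u s1 :: s2))%E.
Proof.
elim: s1 u => [|v s1 IH] u /=; first by rewrite path_weight1 add0e.
by rewrite !path_weight_cons IH addeA.
Qed.

Lemma le_path_weight x y u s :
  (forall i j, (i < j)%N -> (x i j <= y i j)%E) ->
  path ltn u s -> (path_weight x (u :: s) <= path_weight y (u :: s))%E.
Proof.
move=> xy; elim: s u => [|v s IH] u /=; first by rewrite !path_weight1.
by case/andP=> uv pvs; rewrite !path_weight_cons leeD ?xy ?IH.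
Qed.

(** Vertices strictly increase, so a path has at most [last u s - u] edges, each worth at most [M].
    The second conjunct lets the truncated subtractions add up in the induction. *)
Lemma path_weight_le x (M : R) u s : 0 <= M ->
  (forall i j, (i < j)%N -> (x i j <= M%:E)%E) -> path ltn u s ->
  (path_weight x (u :: s) <= ((last u s - u)%:R * M)%:E)%E
  /\ (u <= last u s)%N.
Proof.
move=> M0 xM; elim: s u => [|v s IH] u /=.
  by rewrite path_weight1 subnn mul0r.
case/andP=> uv /IH[IH1 IH2]; split; last by lia.
rewrite path_weight_cons.
apply: le_trans (leeD (xM _ _ uv) IH1) _.
rewrite -EFinD lee_fin -{1}(mul1r M) -mulrDl ler_wpM2r//.
by rewrite nat1r ler_nat; lia.
Qed.

Lemma last_passage_le x (M : R) n : 0 <= M ->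
  (forall i j, (i < j)%N -> (x i j <= M%:E)%E) ->
  (last_passage x n <= (n%:R * M)%:E)%E.
Proof.
move=> M0 xM; apply: ge_ereal_sup => _ [_ [s [-> ps ls]] <-].
by have [] := path_weight_le M0 xM ps; rewrite ls subn0.
Qed.

Lemma path_cut u s c : path ltn u s -> (u <= c < last u s)%N ->
  exists s1 v s2, [/\ s = s1 ++ v :: s2 & (last u s1 <= c < v)%N].
Proof.
elim: s u => [|v s IH] u /=; first by move=> _; lia.
case/andP=> uv pvs cl; have [cv|vc] := ltnP c v.
  by exists [::], v, s; split => //=; lia.
have /IH : (v <= c < last v s)%N by lia.
by move=> /(_ pvs)[s1 [v' [s2 [-> h]]]]; exists (v :: s1), v', s2.
Qed.

(** Lower bounds witnessed by a path compose by concatenation, without handling suprema. The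
    one-vertex path, of weight 0, is allowed. *)
Definition reaches x u v w :=
  exists s, [/\ path ltn u s, last u s = v & (w <= path_weight x (u :: s))%E].

Lemma reaches_trans x u v r w1 w2 :
  reaches x u v w1 -> reaches x v r w2 -> reaches x u r (w1 + w2).
Proof.
move=> [s1 [p1 l1 W1]] [s2 [p2 l2 W2]]; exists (s1 ++ s2).
by rewrite cat_path last_cat l1 p1 p2 path_weight_cat l1 leeD.
Qed.

Lemma reaches_le x u v w w' : (w' <= w)%E -> reaches x u v w -> reaches x u v w'.
Proof. by move=> ww [s [p l W]]; exists s; split=> //; apply: le_trans W. Qed.

Lemma reaches_refl x u : reaches x u u 0%E.
Proof. by exists [::]; rewrite path_weight1. Qed.

Lemma reaches_edge x u v : (u < v)%N -> reaches x u v (x u v).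
Proof.
by move=> uv; exists [:: v]; rewrite path_weight_cons path_weight1 adde0 /= uv.
Qed.

Lemma reaches_last_passage x n w :
  reaches x 0 n w -> (w <= last_passage x n)%E.
Proof.
move=> [s [p l W]]; apply: le_trans W _; apply: ereal_sup_ubound.
by exists (0%N :: s) => //; exists s.
Qed.

Lemma le_last_passage x y n :
  (forall i j, (i < j)%N -> (x i j <= y i j)%E) ->
  (last_passage x n <= last_passage y n)%E.
Proof.
move=> xy; apply: ge_ereal_sup => _ [_ [s [-> ps ls]] <-].
apply: reaches_last_passage; exists s; split => //.
exact: le_path_weight.
Qed.

(** * Gain through one good window, then through many *)

Section Window.
Variables (M : R) (K : nat).
Hypothesis M0 : 0 < M.

Lemma reaches_segment z u v : (u <= v)%N ->
  (forall i, (u <= i < v)%N -> (M%:E <= z i i.+1)%E) ->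
  reaches z u v ((v - u)%:R * M)%:E.
Proof.
move=> uv; rewrite -(subnK uv) addnK; move: (v - u)%N => d.
elim: d => [|d IH] hz; first by rewrite mul0r; exact: reaches_refl.
rewrite addSn -natr1 mulrDl mul1r EFinD.
apply: reaches_trans (IH _) _ => [i ?|]; first by apply: hz; lia.
by apply: reaches_le (reaches_edge _ (ltnSn _)); apply: hz; lia.
Qed.

(** Follow edges worth at least [M] until they enter the window, at a vertex not beyond [c - K]: at
    least [K] unit steps then remain before [c]. The weight of the earlier hops is nonnegative and
    is dropped. *)
Lemma reaches_left z a c : (a + K <= c)%N ->
  (forall i, (i < a)%N ->
    exists j, (i < j <= c - K)%N /\ (M%:E <= z i j)%E) ->
  (forall i, (a <= i < c)%N -> (M%:E <= z i i.+1)%E) ->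
  forall i, (i < a)%N -> reaches z i c (M + K%:R * M)%:E.
Proof.
move=> ac hl hs i ia; have [d] := ubnP (a - i).
elim: d i ia => // d IH i ia aid.
have [j [ij /reaches_le Mz]] := hl _ ia.
have /Mz zij := @reaches_edge z i j ltac:(lia).
have [aj|ja] := leqP a j; rewrite EFinD; apply: reaches_trans zij _.
  apply: reaches_le (reaches_segment (u := j) _ _).
  - by rewrite lee_fin ler_pM2r// ler_nat; lia.
  - by lia.
  - by move=> k ?; apply: hs; lia.
apply: reaches_le (IH j _ _); [|lia|lia].
by rewrite lee_fin lerDr ltW.
Qed.

(** Mirror image of [reaches_left], following edges backwards from [j]. *)
Lemma reaches_right z c b n : (c + K <= b)%N ->
  (forall j, (b < j <= n)%N ->
    exists i, (c + K <= i < j)%N /\ (M%:E <= z i j)%E) ->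
  (forall i, (c <= i < b)%N -> (M%:E <= z i i.+1)%E) ->
  forall j, (b < j <= n)%N -> reaches z c j (K%:R * M + M)%:E.
Proof.
move=> cb hr hs j; elim/ltn_ind: j => j IH bj.
have [i [ij /reaches_le Mz]] := hr _ bj.
have /Mz zij := @reaches_edge z i j ltac:(lia).
rewrite EFinD; apply: reaches_trans zij.
have [ib|bi] := leqP i b.
  apply: reaches_le (reaches_segment (v := i) _ _).
  - by rewrite lee_fin ler_pM2r// ler_nat; lia.
  - by lia.
  - by move=> k ?; apply: hs; lia.
apply: reaches_le (IH i _ _); [|lia|lia].
by rewrite lee_fin lerDl ltW.
Qed.

(* The window is made of the vertices from [a] to [a + 4 K + 1], cut between
   [a + 2 K] and [a + 2 K + 1]. Vertices outside it are linked to the outer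
   part of a half, so that a path entering there still collects [K * M] before
   reaching the cut. *)
Record good_window x y z (t t' : R) (n a : nat) : Prop := GoodWindow {
  good_left : forall i, (i < a)%N ->
    exists j, (i < j <= a + K)%N /\ (M%:E <= x i j)%E;
  good_right : forall j, (a + K.*2.*2.+1 < j <= n)%N ->
    exists i, (a + K.*2 + K.+1 <= i < j)%N /\ (M%:E <= x i j)%E;
  good_segment : forall i, (a <= i < a + K.*2.*2.+1)%N -> i != (a + K.*2)%N ->
    (M%:E <= x i i.+1)%E;
  good_cross : forall i j, (a <= i <= a + K.*2)%N ->
    (a + K.*2 < j <= a + K.*2.*2.+1)%N -> (y i j <= t%:E)%E /\ (t'%:E <= z i j)%E
}.

Section Good.
Variables (x y z : nat -> nat -> \bar R) (t d : R) (n a : nat).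
Hypothesis xz : forall i j, (i < j)%N -> (x i j <= z i j)%E.
Hypothesis yz : forall i j, (i < j)%N -> (y i j <= z i j)%E.
Hypothesis yM : forall i j, (i < j)%N -> (y i j <= M%:E)%E.
Hypothesis d0 : 0 <= d.
Hypothesis Kt : M - t <= K%:R * M.
Hypothesis gw : good_window x y z t (t + d) n a.

(** The detour crosses at the middle edge, worth at least [t + d]. An end lying outside the window
    brings [M + K%:R * M] on its side, and by [Kt] this makes up for the possible shortfall of [t]
    below [M]. *)
Lemma good_window_detour u v : (u <= a + K.*2 < v)%N -> (v <= n)%N ->
  (u < a)%N || (a + K.*2.*2.+1 < v)%N -> reaches z u v (M + d)%:E.
Proof.
move=> uv vn out; case: gw => hl hr hs hc.
set c := (a + K.*2)%N in uv hs hc.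
have cut : reaches z c c.+1 (t + d)%:E.
  by apply: reaches_le (reaches_edge _ (ltnSn _)); apply: (hc _ _ _ _).2; lia.
have hsl i : (a <= i < c)%N -> (M%:E <= z i i.+1)%E.
  by move=> ?; apply: le_trans (hs i _ _) (xz _); lia.
have hsr i : (c.+1 <= i < a + K.*2.*2.+1)%N -> (M%:E <= z i i.+1)%E.
  by move=> ?; apply: le_trans (hs i _ _) (xz _); lia.
have L0 : (a <= u)%N -> reaches z u c 0%:E.
  move=> au; apply: reaches_le (reaches_segment (u := u) _ _); [|lia|].
    by rewrite lee_fin mulr_ge0// ltW.
  by move=> k ?; apply: hsl; lia.
have L1 : (u < a)%N -> reaches z u c (M + K%:R * M)%:E.
  move=> ua; apply: (@reaches_left _ a) => //; first by lia.
  move=> i /hl[j [ij Mj]]; exists j; split; first by lia.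
  by apply: le_trans Mj (xz _); lia.
have R0 : (v <= a + K.*2.*2.+1)%N -> reaches z c.+1 v 0%:E.
  move=> av; apply: reaches_le (reaches_segment (u := c.+1) (v := v) _ _).
  - by rewrite lee_fin mulr_ge0// ltW.
  - by lia.
  - by move=> k ?; apply: hsr; lia.
have R1 : (a + K.*2.*2.+1 < v)%N -> reaches z c.+1 v (K%:R * M + M)%:E.
  move=> av; apply: (@reaches_right _ _ (a + K.*2.*2.+1) n) => //.
  - by lia.
  - move=> j /hr[i [ij Mj]]; exists i; split; first by lia.
    by apply: le_trans Mj (xz _); lia.
  - by lia.
have KM0 : 0 <= K%:R * M by rewrite mulr_ge0// ltW.
have := (M0, Kt); move: L1 R1 KM0.
move: (K%:R * M) => KM L1 R1 KM0 [M_gt0 KMt].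
have [au|ua] := leqP a u; have [vb|bv] := leqP v (a + K.*2.*2.+1).
- by move: out; rewrite !ltnNge au vb.
- apply: reaches_le (reaches_trans (reaches_trans (L0 au) cut) (R1 bv)).
  by rewrite -!EFinD lee_fin; lra.
- apply: reaches_le (reaches_trans (reaches_trans (L1 ua) cut) (R0 vb)).
  by rewrite -!EFinD lee_fin; lra.
- apply: reaches_le (reaches_trans (reaches_trans (L1 ua) cut) (R1 bv)).
  by rewrite -!EFinD lee_fin; lra.
Qed.

Lemma good_window_reaches u v : (u <= a + K.*2 < v)%N -> (v <= n)%N ->
  reaches z u v (y u v + d%:E)%E.
Proof.
move=> uv vn; have uvlt : (u < v)%N by lia.
have [/(good_window_detour uv vn)|] := boolP ((u < a)%N || (a + K.*2.*2.+1 < v)%N).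
  by apply: reaches_le; rewrite EFinD leeD2r// yM.
move=> inn; apply: reaches_le (reaches_edge _ uvlt).
have [yt tz] := good_cross gw (i := u) (j := v) ltac:(lia) ltac:(lia).
by apply: le_trans tz; rewrite EFinD leeD2r.
Qed.

Lemma good_window_gain : (a + K.*2.*2.+1 < n)%N ->
  (maxe (last_passage y n) 0 + d%:E <= maxe (last_passage z n) 0)%E.
Proof.
move=> an; rewrite -leeBrDr// ge_max; apply/andP; split; last first.
  rewrite leeBrDr// add0e le_max; apply/orP; left.
  apply: reaches_last_passage.
  apply: reaches_le (good_window_detour (u := 0%N) (v := n) _ _ _); try lia.
  by rewrite lee_fin lerDr ltW.
apply: ge_ereal_sup => _ [_ [s [-> ps ls]] <-].
rewrite leeBrDr// le_max; apply/orP; left.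
(* The edge from [last 0 s1] to [v] jumps over the middle and yields the gain; the two other pieces
   are kept, since [y] is below [z]. *)
have [s1 [v [s2 [sE cv]]]] := @path_cut 0 s (a + K.*2)%N ps ltac:(lia).
apply: reaches_last_passage; subst s.
move: ps ls; rewrite cat_path last_cat /= => /and3P[p1 lv p2] ls.
have vn : (v <= n)%N by rewrite -ls; have [] := path_weight_le (ltW M0) yM p2.
rewrite path_weight_cat path_weight_cons.
have := reaches_trans (reaches_trans
    (ex_intro _ s1 (And3 p1 erefl (le_path_weight yz p1)))
    (good_window_reaches cv vn))
  (ex_intro _ s2 (And3 p2 ls (le_path_weight yz p2))).
by apply: reaches_le; rewrite -!addeA (addeC _ d%:E).
Qed.

End Good.

(* Switching the edges from [x1] to [x2] by increasing right end point changes
   the edges across one window at a time, so that the gains add up. *)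
Definition switched (x1 x2 : nat -> nat -> \bar R) (m : nat) :=
  fun i j => if (j < m)%N then x2 i j else x1 i j.

Local Notation L := (K.*2.*2.+2).

(** Goodness refers to the original [x1] and [x2] only, so it does not depend on the stage of the
    switching. The windows are disjoint blocks of [L] vertices, treated one per induction step. *)
Lemma last_passage_gain x1 x2 t d n m : 0 <= d -> M - t <= K%:R * M ->
  (forall i j, (i < j)%N -> (x1 i j <= x2 i j <= M%:E)%E) ->
  (m * L <= n)%N ->
  (maxe (last_passage x1 n) 0 +
   (d * \sum_(k < m) `[< good_window x1 x1 x2 t (t + d) n (k * L) >]%:R)%:E <=
   maxe (last_passage x2 n) 0)%E.
Proof.
move=> d0 Kt x12 mn.
have x1M i j : (i < j)%N -> (x1 i j <= M%:E)%E.
  by move=> /x12/andP[]; exact: le_trans.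
suff : (maxe (last_passage x1 n) 0 +
   (d * \sum_(k < m) `[< good_window x1 x1 x2 t (t + d) n (k * L) >]%:R)%:E <=
   maxe (last_passage (switched x1 x2 (m * L)) n) 0)%E.
  move=> /le_trans; apply; apply: Order.TotalTheory.le_max2 => //.
  by apply: le_last_passage => i j /x12/andP[]; rewrite /switched; case: ifP.
elim: m mn => [|m IH] mn.
  by rewrite big_ord0 mulr0 adde0.
rewrite big_ord_recr /= mulrDr EFinD addeA.
apply: le_trans (leeD2r _ (IH _)) _; first by lia.
have sle i j : (i < j)%N ->
    (switched x1 x2 (m * L) i j <= switched x1 x2 (m.+1 * L) i j)%E.
  move=> /x12/andP[le12 _]; rewrite /switched.
  by case: ltnP => ?; case: ltnP => //; lia.
case: asboolP => [gw|_]; last first.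
  rewrite mulr0 adde0; apply: Order.TotalTheory.le_max2 => //.
  exact: le_last_passage.
rewrite mulr1; apply: (@good_window_gain x1 _ _ t d n (m * L)) => //.
- move=> i j /x12/andP[? _]; rewrite /switched; case: ifP => //.
- by move=> i j ij; have /andP[? ?] := x12 _ _ ij; rewrite /switched; case: ifP => // _; exact: x1M.
(* The right end of a crossing edge lies in [[m * L, m.+1 * L)]: the edge still carries [x1] before
   this step and carries [x2] after it. *)
- case: gw => hl hr hs hc; split => // i j ai aj.
  rewrite /switched ifF; last by lia.
  rewrite ifT; last by lia.
  exact: hc.
- by lia.
Qed.

End Window.
End Paths.

(** * Quantile coupling *)

Section Quantile.
Context {R : realType}.
Implicit Types (nu : probability (\bar R) R) (u r a b : R).

Lemma measurable_le_ereal r : measurable [set x : \bar R | (x <= r%:E)%E].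
Proof.
rewrite (_ : [set _ | _] = `]-oo, r%:E]%classic); first exact: emeasurable_itv.
by apply/seteqP; split=> x; rewrite /= in_itv.
Qed.

(** Closed half-lines form a generating pi-system. The full set is added to it because the
    half-lines do not cover [+oo]. *)
Lemma measure_ereal_unique (m1 m2 : {measure set (\bar R) -> \bar R}) :
  (m1 setT < +oo)%E -> m1 setT = m2 setT ->
  (forall r, m1 [set x | (x <= r%:E)%E] = m2 [set x | (x <= r%:E)%E]) ->
  forall A, measurable A -> m1 A = m2 A.
Proof.
move=> m1T m12T m12 A mA.
pose G : set (set (\bar R)) :=
  [set setT] `|` [set B | exists r, B = [set x | (x <= r%:E)%E]].
apply: (measure_unique G (fun=> setT)) => //.
- apply/seteqP; split.
    rewrite [X in X `<=` _](ErealGenOInfty.measurableE R).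
    apply: smallest_sub; first exact: smallest_sigma_algebra.
    move=> _ [r ->]; rewrite -[X in <<s _ >> X]setCK.
    apply: (@measurableC _ (g_sigma_algebraType G)); apply: sub_sigma_algebra.
    right; exists r; apply/seteqP; split=> x /=; rewrite in_itv/= andbT.
      by move/negP; rewrite -leNgt.
    by move=> xr; apply/negP; rewrite -leNgt.
  apply: smallest_sub; first exact: sigma_algebra_measurable.
  by move=> _ [->//|[r ->]]; exact: measurable_le_ereal.
- move=> B C [->|[r ->]] [->|[s ->]].
  + by rewrite setIT; left.
  + by rewrite setTI; right; exists s.
  + by rewrite setIT; right; exists r.
  + right; exists (Num.min r s); apply/seteqP; split=> x /=; rewrite EFin_min le_min.
      by move=> [-> ->].
    by move/andP.
- by left.
- by apply/seteqP; split=> // x _; exists 0%N.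
- by move=> B [->//|[r ->]].
Qed.

(** Right continuity of the distribution function: the half-line at [r] is the decreasing
    intersection of the sets [F n]. *)
Lemma le_law_right nu r (p : \bar R) :
  (forall s, r < s -> (p <= nu [set x | (x <= s%:E)%E])%E) ->
  (p <= nu [set x | (x <= r%:E)%E])%E.
Proof.
move=> h; pose F n := [set x : \bar R | (x <= (r + n.+1%:R^-1)%:E)%E].
have FE : \bigcap_n F n = [set x | (x <= r%:E)%E].
  apply/seteqP; split=> x /=.
    move=> Fx; rewrite leNgt; apply/negP => rx.
    have [s rs sx] : exists2 s : R, r < s & (s%:E < x)%E.
      move: x rx {Fx} => [x| |]//=; rewrite ?lte_fin => rx.
        by exists ((r + x) / 2); rewrite ?lte_fin; lra.
      by exists (r + 1); rewrite ?ltry// ltrDl.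
    have [k rks] := ltr_add_invr rs.
    by have := Fx k I; rewrite /F /= leNgt (lt_trans _ sx)// lte_fin.
  by move=> xr n _; apply: le_trans xr _; rewrite lee_fin lerDl.
have cF : nu \o F @ \oo --> nu (\bigcap_n F n).
  apply: nonincreasing_cvg_mu.
  - by rewrite (le_lt_trans (probability_le1 _ _)) ?ltry//; exact: measurable_le_ereal.
  - by move=> i; exact: measurable_le_ereal.
  - by rewrite FE; exact: measurable_le_ereal.
  - move=> m n mn; apply/subsetPset => x /le_trans; apply.
    by rewrite lee_fin lerD2l lef_pV2 ?posrE// ler_nat.
rewrite -FE -(cvg_lim _ cF)//; apply: lime_ge; first by apply/cvg_ex; exists (nu (\bigcap_n F n)).
by apply: nearW => n; apply: h; rewrite ltrDl.
Qed.

(* Generalised inverse of the distribution function of [nu], capped at [M] so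
   that the bound by [M] holds for every [u], including [1 < u]. *)
Definition quantile (M : R) nu u : \bar R :=
  ereal_inf [set r%:E | r in
    [set r | M <= r \/ (u%:E <= nu [set x | (x <= r%:E)%E])%E]].

(** Galois connection between quantile and distribution function; the direct implication says that
    the infimum is attained, by right continuity. *)
Lemma quantile_leP M nu u r :
  (quantile M nu u <= r%:E)%E <->
  M <= r \/ (u%:E <= nu [set x | (x <= r%:E)%E])%E.
Proof.
split=> [ur|]; last by move=> h; apply: ereal_inf_lbound; exists r.
have [Mr|rM] := lerP M r; [by left|right].
apply: le_law_right => s rs.
(* Staying below [M] as well as [s] rules out that the real [q < s'] found below enters the infimum
   only through the cap [M <= q]. *)
have [s' rs' s's] : exists2 s', r < s' & s' < s /\ s' < M.
  exists ((r + Num.min s M) / 2); first by have := lt_min r s M; rewrite rs rM /=; lra.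
  have : r < Num.min s M by rewrite lt_min rs rM.
  have : Num.min s M <= s by rewrite ge_min lexx.
  have : Num.min s M <= M by rewrite ge_min lexx orbT.
  by lra.
have : (quantile M nu u < s'%:E)%E by apply: le_lt_trans ur _; rewrite lte_fin.
move/ereal_inf_lt => [_ [q [Mq|uq] <-]]; rewrite lte_fin => qs'.
  by case: s's => _ /(lt_trans qs'); rewrite ltNge Mq.
apply: le_trans uq _; apply: le_measure; rewrite ?inE; try exact: measurable_le_ereal.
by move=> x /= /le_trans; apply; rewrite lee_fin (le_trans (ltW qs'))// ltW// s's.1.
Qed.

Lemma quantile_leM M nu u : (quantile M nu u <= M%:E)%E.
Proof. by apply/quantile_leP; left. Qed.

Lemma le_quantile M nu1 nu2 u : stochastically_dominated nu1 nu2 ->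
  (quantile M nu1 u <= quantile M nu2 u)%E.
Proof.
move=> dom; apply: le_ereal_inf => _ [r [Mr|ur] <-]; exists r => //.
  by left.
by right; apply: le_trans ur (dom r).
Qed.

Local Notation U := (uniform_prob (@ltr01 R)).

Lemma uniform_probE A : measurable A ->
  U A = lebesgue_measure (A `&` `[0, 1]%classic).
Proof.
move=> mA; rewrite /uniform_prob integral_uniform_pdf.
rewrite (eq_integral (cst 1%E)).
  by rewrite integral_cst ?mul1e//; apply: measurableI.
move=> x; rewrite inE => -[_ /=]; rewrite in_itv /= /uniform_pdf => ->.
by rewrite subr0 invr1.
Qed.

Lemma uniform_prob_itvoc a b : 0 <= a -> a <= b -> b <= 1 ->
  U `]a, b]%classic = (b - a)%:E.
Proof.
move=> a0 ab b1; rewrite uniform_probE// setIidl.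
  rewrite lebesgue_measure_itv/= lte_fin; case: ltP ab => // ba ab.
  by have -> : a = b; [lra|rewrite subrr].
by move=> x /=; rewrite !in_itv/= => /andP[? ?]; lra.
Qed.

Lemma uniform_prob_le b : 0 <= b -> b <= 1 -> U [set u | u <= b] = b%:E.
Proof.
move=> b0 b1; rewrite uniform_probE; last by rewrite -set_itvNyc.
rewrite (_ : _ `&` _ = `[0, b]%classic); last first.
  apply/seteqP; split=> x /=; rewrite !in_itv/=; lra.
rewrite lebesgue_measure_itv/= lte_fin.
case: ltP b0 => // [_ _|b0 b0']; first by rewrite sube0.
by have -> : b = 0 by lra.
Qed.

Lemma quantile_preimage M nu r : nu [set x | (x <= M%:E)%E] = 1%E -> r < M ->
  quantile M nu @^-1` [set x | (x <= r%:E)%E] =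
  [set u | u <= fine (nu [set x | (x <= r%:E)%E])].
Proof.
move=> nuM rM; apply/seteqP; split=> u /=.
  move/quantile_leP => [|]; first by rewrite leNgt rM.
  rewrite -lee_fin fineK ?fin_num_measure//; exact: measurable_le_ereal.
move=> h; apply/quantile_leP; right; move: h.
rewrite -lee_fin fineK ?fin_num_measure//; exact: measurable_le_ereal.
Qed.

Lemma quantile_preimageM M nu r : M <= r ->
  quantile M nu @^-1` [set x | (x <= r%:E)%E] = setT.
Proof. by move=> Mr; apply/seteqP; split=> u //= _; apply/quantile_leP; left. Qed.

Lemma measurable_quantile M nu : nu [set x | (x <= M%:E)%E] = 1%E ->
  measurable_fun setT (quantile M nu).
Proof.
move=> nuM; apply: (measurability _ (ErealGenOInfty.measurableE R)).
move=> _ [_ [r ->] <-]; rewrite setTI.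
rewrite (_ : _ @^-1` _ = ~` (quantile M nu @^-1` [set x | (x <= r%:E)%E])).
  apply: measurableC; have [Mr|rM] := lerP M r.
    by rewrite quantile_preimageM.
  by rewrite quantile_preimage// -set_itvNyc.
apply/seteqP; split=> x /=; rewrite in_itv/= andbT.
  by rewrite ltNge => /negP.
by move/negP; rewrite -ltNge.
Qed.

(** Inverse transform sampling, checked on half-lines: the cap changes nothing because [nu] already
    has mass 1 below [M]. *)
Lemma quantile_law M nu : nu [set x | (x <= M%:E)%E] = 1%E ->
  forall B, measurable B -> U (quantile M nu @^-1` B) = nu B.
Proof.
move=> nuM B mB.
have mq := measurable_quantile nuM.
pose mqm := isMeasurableFun.Build _ _ _ _ (quantile M nu) mq.
pose q : {mfun _ >-> _} := HB.pack (quantile M nu) mqm.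
rewrite -[LHS]/(pushforward U q B).
apply: measure_ereal_unique mB.
- by rewrite /= /pushforward preimage_setT probability_setT ltry.
- by rewrite /= /pushforward preimage_setT !probability_setT.
move=> r; rewrite /= /pushforward.
have mr := measurable_le_ereal r.
have [Mr|rM] := lerP M r.
  rewrite quantile_preimageM// probability_setT; apply/esym/eqP.
  rewrite eq_le probability_le1//= -nuM le_measure ?inE//.
    exact: measurable_le_ereal.
  by move=> x /= /le_trans; apply; rewrite lee_fin.
rewrite quantile_preimage//.
rewrite uniform_prob_le.
- by rewrite fineK// fin_num_measure.
- by rewrite fine_ge0.
- by rewrite -lee_fin fineK ?fin_num_measure// probability_le1.
Qed.

(** Without a gap, the distribution function of [nu1] at [r] is at most that of [nu2] at every
    [s > r], hence at [r] by right continuity; domination then makes the two laws equal. *)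
Lemma dominated_gap nu1 nu2 : ~ same_distribution nu1 nu2 ->
  stochastically_dominated nu1 nu2 ->
  exists t d, 0 < d /\ (nu2 [set x | (x <= (t + d)%:E)%E] < nu1 [set x | (x <= t%:E)%E])%E.
Proof.
move=> neq dom; apply: contrapT => h; apply: neq => A mA.
apply: measure_ereal_unique mA => //.
- by rewrite [X in (X < _)%E]probability_setT ltry.
- by rewrite [LHS]probability_setT [RHS]probability_setT.
move=> r; apply/eqP; rewrite eq_le dom andbT.
apply: le_law_right => s rs; rewrite leNgt; apply/negP => lt21.
by apply: h; exists r, (s - r); rewrite subr_gt0 addrC subrK.
Qed.

Lemma measurable_quantile_gap M nu1 nu2 s r :
  nu1 [set x | (x <= M%:E)%E] = 1%E -> nu2 [set x | (x <= M%:E)%E] = 1%E ->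
  measurable
    [set u | (quantile M nu1 u <= s%:E)%E /\ (r%:E <= quantile M nu2 u)%E].
Proof.
move=> nuM1 nuM2.
rewrite (_ : [set u | _] = quantile M nu1 @^-1` [set x | (x <= s%:E)%E] `&`
    quantile M nu2 @^-1` `[r%:E, +oo[%classic).
  apply: measurableI; rewrite -[X in measurable X]setTI.
    by apply: measurable_quantile => //; exact: measurable_le_ereal.
  by apply: measurable_quantile => //; exact: emeasurable_itv.
by apply/seteqP; split=> u /=; rewrite in_itv/= andbT.
Qed.

(** Every [u] above the distribution function of [nu2] at [t + d] and at most that of [nu1] at [t]
    belongs to the set, and these [u] fill an interval of positive length. *)
Lemma quantile_gap M nu1 nu2 t d :
  nu1 [set x | (x <= M%:E)%E] = 1%E -> nu2 [set x | (x <= M%:E)%E] = 1%E ->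
  0 <= d -> (nu2 [set x | (x <= (t + d)%:E)%E] < nu1 [set x | (x <= t%:E)%E])%E ->
  (0 < U [set u | (quantile M nu1 u <= t%:E)%E /\ ((t + d)%:E <= quantile M nu2 u)%E])%E.
Proof.
move=> nuM1 nuM2 d0 lt21.
set F2 := nu2 _ in lt21; set F1 := nu1 _ in lt21.
have F2f : F2 \is a fin_num by rewrite fin_num_measure//; exact: measurable_le_ereal.
have F1f : F1 \is a fin_num by rewrite fin_num_measure//; exact: measurable_le_ereal.
have F1le : (F1 <= 1)%E by apply: probability_le1; exact: measurable_le_ereal.
have F20 : (0 <= F2)%E by exact: measure_ge0.
(* Otherwise [F2 = 1], which contradicts [F2 < F1]. Hence the cap does not interfere at [t + d]. *)
have tdM : t + d < M.
  rewrite ltNge; apply/negP => Mt; move: lt21; rewrite ltNge => /negP; apply.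
  apply: le_trans F1le _; rewrite -nuM2.
  apply: le_measure; rewrite ?inE; try exact: measurable_le_ereal.
  by move=> x /= /le_trans; apply; rewrite lee_fin.
have gap : (0 < U `]fine F2, fine F1]%classic)%E.
  have F11 : fine F1 <= 1 by rewrite -lee_fin fineK.
  have F12 : fine F2 < fine F1 by rewrite fine_lt.
  rewrite uniform_prob_itvoc ?fine_ge0//; last exact: ltW.
  by rewrite lte_fin subr_gt0.
apply: lt_le_trans gap _; apply: le_measure; rewrite ?inE//.
  exact: measurable_quantile_gap.
move=> u /=; rewrite in_itv/= => /andP[F2u uF1]; split.
  by apply/quantile_leP; right; rewrite -/F1 -(fineK F1f) lee_fin.
rewrite leNgt; apply/negP => /ltW/quantile_leP[|]; first by rewrite leNgt tdM.
by rewrite -/F2 -(fineK F2f) lee_fin leNgt F2u.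
Qed.

End Quantile.

(** * Independent families and laws *)

Section Independent.
Context {R : realType}.

(** One product factor is added per index of [es]. A finite family suffices, as a passage value up
    to [n] involves finitely many edges. *)
Lemma independent_family (d0 : measure_display) (T0 : measurableType d0)
    (mu : probability T0 R) (I : choiceType) (es : seq I) : uniq es ->
  exists (d : measure_display) (T : measurableType d) (P : probability T R)
    (V : I -> T -> T0),
    (forall e, measurable_fun setT (V e)) /\
    (forall B : I -> set T0, (forall e, measurable (B e)) ->
      P (\bigcap_(e in [set` es]) (V e @^-1` B e)) =
      (\prod_(e <- es) mu (B e))%E).
Proof.
elim: es => [_|e es IH /= /andP[ees /IH]].
  exists d0, T0, mu, (fun _ => id); split => [e|B mB]; first exact: measurable_id.
  by rewrite set_nil bigcap_set0 big_nil probability_setT.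
move=> [d [T [P [V [mV PV]]]]].
pose V' i (w : T * T0) := if i == e then w.2 else V i w.1.
exists _, (T * T0)%type, (P \x mu)%E, V'; split => [i|B mB].
  rewrite /V'; case: eqP => _; first exact: measurable_snd.
  by apply: measurableT_comp (mV i) _; exact: measurable_fst.
rewrite big_cons -PV// muleC.
rewrite -product_measure1E//; last first.
  by apply: fin_bigcap_measurable => // i _; rewrite -[X in measurable X]setTI; exact: mV.
congr (_ _); apply/seteqP; split=> [w h|w [h1 h2] i /=].
  split => [i /= ies|/=]; last by have := h e; rewrite /= mem_head /V' eqxx; apply.
  have := h i; rewrite /= in_cons ies orbT /V'; case: eqP => [ie|_]; last by apply.
  by move: ees; rewrite -ie ies.
by rewrite in_cons /V'; case: eqP => [->//|_ /= /h1].
Qed.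

(** Pi-system generating a sigma-algebra on configurations, the common target on which the laws of
    two weight families are compared. Its members have the form used to express independence in
    [iid_weights]. *)
Definition cylinders (E : {fset nat * nat}) : set (set (nat * nat -> \bar R)) :=
  [set A | exists B : nat * nat -> set (\bar R), (forall e, measurable (B e)) /\
    A = \bigcap_(e in [set` E]) ((fun x => x e) @^-1` B e)].

Lemma measurable_coordinate E e : e \in E ->
  measurable_fun setT
    ((fun x => x e) : g_sigma_algebraType (cylinders E) -> \bar R).
Proof.
move=> eE _ A mA; rewrite setTI; apply: sub_sigma_algebra.
exists (fun e' => if e' == e then A else setT); split.
  by move=> e'; case: ifP.
apply/seteqP; split=> x /= h => [e' _ /=|].
  by case: eqP => [->|].
by have := h e eE; rewrite /= eqxx.
Qed.

(** The supremum exceeds [r] exactly when some path does, and the paths lie in the countable type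
    [seq nat]; sequences that are not paths contribute [set0]. *)
Lemma measurable_last_passage (d : measure_display) (T : measurableType d)
    (x : nat -> nat -> T -> \bar R) n :
  (forall i j, (i < j <= n)%N -> measurable_fun setT (x i j)) ->
  measurable_fun setT (fun w => last_passage (fun i j => x i j w) n).
Proof.
move=> mx.
have mpw s u : path ltn u s -> (last u s <= n)%N ->
    (u <= last u s)%N /\ measurable_fun setT
      (fun w => path_weight (fun i j => x i j w) (u :: s)).
  elim: s u => [|v s IH] u /=.
    move=> _ _; split => //.
    apply: (eq_measurable_fun (cst 0%E)) => //.
    by move=> w _; rewrite path_weight1.
  case/andP=> uv pv ln; have [vl mv] := IH _ pv ln; split; first by lia.
  apply: (eq_measurable_fun (fun w => x u v w + path_weight (fun i j => x i j w) (v :: s))%E).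
    by move=> w _; rewrite path_weight_cons.
  by apply: emeasurable_funD => //; apply: mx; lia.
apply: (measurability _ (ErealGenOInfty.measurableE R)).
move=> _ [_ [r ->] <-]; rewrite setTI.
pose F (s : seq nat) := if path ltn 0%N s && (last 0%N s == n) then
  (fun w => path_weight (fun i j => x i j w) (0%N :: s)) @^-1` `]r%:E, +oo[%classic
  else set0.
rewrite (_ : _ @^-1` _ = \bigcup_s F s).
  apply: countable_bigcupT_measurable => [//|s].
  rewrite /F; case: ifPn => // /andP[ps /eqP ls].
  rewrite -[X in measurable X]setTI; have [||_] := mpw s 0%N => //.
    by rewrite ls.
  by apply => //; exact: emeasurable_itv.
apply/seteqP; split=> w /=.
  rewrite in_itv/= andbT => /ereal_sup_gt[_ [_ [s [-> ps ls]] <-] rw].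
  by exists s => //; rewrite /F ps ls eqxx /= in_itv/= andbT.
move=> [s _]; rewrite /F; case: ifPn => // /andP[ps /eqP ls] /=.
rewrite !in_itv/= !andbT => /lt_le_trans; apply.
by apply: ereal_sup_ubound; exists (0%N :: s) => //; exists s.
Qed.

(** Two families agreeing on cylinders have the same image law on configurations. This carries
    expectations from an arbitrary space bearing the weights to the coupling space. *)
Lemma eq_law_last_passage (d1 d2 : measure_display)
    (T1 : measurableType d1) (T2 : measurableType d2)
    (P1 : probability T1 R) (P2 : probability T2 R)
    (X1 : nat * nat -> T1 -> \bar R) (X2 : nat * nat -> T2 -> \bar R)
    (E : {fset nat * nat}) n (h : \bar R -> \bar R) :
  (forall i j, (i < j <= n)%N -> (i, j) \in E) ->
  (forall e, e \in E -> measurable_fun setT (X1 e)) ->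
  (forall e, e \in E -> measurable_fun setT (X2 e)) ->
  (forall B, (forall e, measurable (B e)) ->
    P1 (\bigcap_(e in [set` E]) (X1 e @^-1` B e)) =
    P2 (\bigcap_(e in [set` E]) (X2 e @^-1` B e))) ->
  measurable_fun setT h -> (forall y, (0 <= h y)%E) ->
  (\int[P1]_w h (last_passage (fun i j => X1 (i, j) w) n) =
   \int[P2]_w h (last_passage (fun i j => X2 (i, j) w) n))%E.
Proof.
move=> hE mX1 mX2 PX mh h0.
pose S := g_sigma_algebraType (cylinders E).
pose f (x : S) := h (last_passage (fun i j => x (i, j)) n).
have mf : measurable_fun setT f.
  apply: measurableT_comp mh _; apply: (@measurable_last_passage _ S (fun i j x => x (i, j))).
  by move=> i j ij; apply: measurable_coordinate; exact: hE.
have mcfg (d : measure_display) (T : measurableType d) (X : nat * nat -> T -> \bar R) :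
    (forall e, e \in E -> measurable_fun setT (X e)) ->
    measurable_fun setT ((fun w e => X e w) : T -> S).
  move=> mX; apply: (@measurability _ _ T S setT _ (cylinders E) erefl).
  move=> _ [_ [B [mB ->]] <-]; rewrite setTI preimage_bigcap.
  apply: fin_bigcap_measurable => // e eE.
  by rewrite -[X in measurable X]setTI; exact: mX.
pose c1 : {mfun _ >-> _} :=
  HB.pack ((fun w e => X1 e w) : T1 -> S) (isMeasurableFun.Build _ _ _ _ _ (mcfg _ _ _ mX1)).
pose c2 : {mfun _ >-> _} :=
  HB.pack ((fun w e => X2 e w) : T2 -> S) (isMeasurableFun.Build _ _ _ _ _ (mcfg _ _ _ mX2)).
transitivity (\int[pushforward P1 c1]_(x in setT) f x)%E.
  rewrite (ge0_integral_pushforward (mcfg _ _ _ mX1))// => y _; exact: h0.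
transitivity (\int[pushforward P2 c2]_(x in setT) f x)%E; last first.
  rewrite (ge0_integral_pushforward (mcfg _ _ _ mX2))// => y _; exact: h0.
apply: eq_measure_integral => A mA _.
apply: (@measure_unique _ R S (cylinders E) (fun=> setT) erefl _ _ _
  (pushforward P1 c1) (pushforward P2 c2)) => //.
- move=> _ _ [B [mB ->]] [C [mC ->]]; exists (fun e => B e `&` C e); split.
    by move=> e; exact: measurableI.
  by rewrite -bigcapI.
- move=> _; exists (fun=> setT); split => //.
  by apply/seteqP; split.
- by apply/seteqP; split=> // x _; exists 0%N.
- move=> _ [B [mB ->]]; rewrite /= /pushforward !preimage_bigcap.
  exact: PX.
- by move=> _; rewrite /= /pushforward preimage_setT probability_setT ltry.
Qed.

End Independent.

(** * Probability of a good window *)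

Section ProductBounds.
Context {R : realType} {I : eqType}.
Implicit Types (r s : seq I) (a : pred I) (q : R).

(** The product is [q] to the number of entries of [r] satisfying [a], a number that [s] bounds from
    below here and from above in [prod_if_ge]. *)
Lemma prod_if_le r s a q : 0 <= q -> q <= 1 -> uniq s ->
  {subset s <= r} -> all a s ->
  \prod_(e <- r) (if a e then q else 1) <= q ^+ size s.
Proof.
move=> q0 q1 us sr as_; rewrite -big_mkcond big_const_seq iter_mulr_1.
apply: ler_wiXn2l => //; rewrite -size_filter; apply: uniq_leq_size => // e es.
by rewrite mem_filter (allP as_)//= sr.
Qed.

Lemma prod_if_ge r s a q : 0 <= q -> q <= 1 -> uniq r ->
  (forall e, e \in r -> a e -> e \in s) ->
  q ^+ size s <= \prod_(e <- r) (if a e then q else 1).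
Proof.
move=> q0 q1 ur rs; rewrite -big_mkcond big_const_seq iter_mulr_1.
apply: ler_wiXn2l => //; rewrite -size_filter; apply: uniq_leq_size.
  exact: filter_uniq.
by move=> e; rewrite mem_filter => /andP[ae er]; exact: rs.
Qed.


End ProductBounds.

Section GoodProb.
Context {R : realType} (d0 : measure_display) (T0 : measurableType d0).
Variables (mu : probability T0 R) (Ms Gs : set T0).
Hypotheses (mMs : measurable Ms) (mGs : measurable Gs).

Local Notation f A := (fine (mu A)).
Local Notation q := (1 - f Ms).

Variable K : nat.
Implicit Types (a n i j : nat) (e : nat * nat).

Definition segment_edge a e :=
  [&& (a <= e.1 < a + K.*2.*2.+1)%N, e.2 == e.1.+1 & e.1 != (a + K.*2)%N].

Definition cross_edge a e :=
  (a <= e.1 <= a + K.*2)%N && (a + K.*2 < e.2 <= a + K.*2.*2.+1)%N.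

Definition left_edge a i e := (e.1 == i) && (e.2 <= a + K)%N.

Definition right_edge a j e := (e.2 == j) && (a + K.*2 + K.+1 <= e.1)%N.

(** Constraint put by the window on the variable of edge [e]. In the application [Ms] is where the
    first quantile equals [M], and [Gs] is where the two quantiles are separated by the gap. *)
Definition window_box a e : set T0 :=
  if segment_edge a e then Ms else if cross_edge a e then Gs else setT.

(** Failure at vertex [i]: the window itself is as wanted, but no edge from [i] to a vertex up to
    [a + K] is worth [M]. *)
Definition left_box a i e := if left_edge a i e then ~` Ms else window_box a e.

Definition right_box a j e := if right_edge a j e then ~` Ms else window_box a e.

Context (d : measure_display) (T : measurableType d) (P : probability T R).
Variables (V : nat * nat -> T -> T0) (E : {fset nat * nat}) (n : nat).
Hypothesis mV : forall e, measurable_fun setT (V e).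
Hypothesis PV : forall B : nat * nat -> set T0, (forall e, measurable (B e)) ->
  P (\bigcap_(e in [set` E]) (V e @^-1` B e)) = (\prod_(e <- E) mu (B e))%E.
Hypothesis memE : forall i j, ((i, j) \in E) = (i < j <= n)%N.

Definition box (B : nat * nat -> set T0) : set T :=
  \bigcap_(e in [set` E]) (V e @^-1` B e).

Lemma measurable_box B : (forall e, measurable (B e)) -> measurable (box B).
Proof.
move=> mB; apply: fin_bigcap_measurable => // e _.
by rewrite -[X in measurable X]setTI; exact: mV.
Qed.

Lemma box_prob B : (forall e, measurable (B e)) ->
  P (box B) = (\prod_(e <- E) f (B e))%:E.
Proof.
move=> mB; rewrite PV// -prodEFin; apply: eq_bigr => e _.
by rewrite fineK// fin_num_measure.
Qed.

Lemma measurable_window_box a e : measurable (window_box a e).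
Proof. by rewrite /window_box; case: ifP => // _; case: ifP. Qed.

Lemma measurable_left_box a i e : measurable (left_box a i e).
Proof.
by rewrite /left_box; case: ifP => _;
  [exact: measurableC|exact: measurable_window_box].
Qed.

Lemma measurable_right_box a j e : measurable (right_box a j e).
Proof.
by rewrite /right_box; case: ifP => _;
  [exact: measurableC|exact: measurable_window_box].
Qed.

Let f_ge0 A : 0 <= f A. Proof. by rewrite fine_ge0. Qed.

Let f_le1 A : measurable A -> f A <= 1.
Proof.
by move=> mA; rewrite -lee_fin fineK ?fin_num_measure// probability_le1.
Qed.

Let f_setT : f setT = 1. Proof. by rewrite probability_setT. Qed.

Let f_setC : f (~` Ms) = q.
Proof.
rewrite probability_setC// fineB ?fin_num_measure//=.
Qed.

(** The affected edges are free of window constraints, so by independence each one multiplies the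
    probability of the window by [q]. *)
Lemma box_prob_bad a (aff : pred (nat * nat)) (s : seq (nat * nat)) :
  (forall e, e \in E -> aff e -> window_box a e = setT) ->
  uniq s -> {subset s <= E} -> all aff s ->
  (P (box (fun e => if aff e then ~` Ms else window_box a e)) <=
   P (box (window_box a)) * (q ^+ size s)%:E)%E.
Proof.
move=> affT us sE affs; rewrite !box_prob; last 2 first.
- exact: measurable_window_box.
- by move=> e; case: ifP => _; [exact: measurableC|exact: measurable_window_box].
rewrite -EFinM lee_fin.
rewrite (eq_big_seq (fun e => f (window_box a e) * (if aff e then q else 1))).
  rewrite big_split /= ler_wpM2l//; first by apply: prodr_ge0.
  by apply: prod_if_le => //; rewrite ?subr_ge0 ?f_le1// gerBl.
move=> e eE /=; case: ifPn => [ae|_]; last by rewrite mulr1.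
by rewrite (affT e eE ae) f_setT mul1r f_setC.
Qed.

Lemma left_prob a i : (a + K.*2.*2.+1 < n)%N -> (i < a)%N ->
  (P (box (left_box a i)) <=
   P (box (window_box a)) * (q ^+ (a - i + K))%:E)%E.
Proof.
move=> an ia.
have := @box_prob_bad a (left_edge a i) [seq (i, j) | j <- iota i.+1 (a - i + K)].
rewrite size_map size_iota; apply.
- move=> [x y]; rewrite memE /left_edge /window_box /segment_edge /cross_edge /=.
  by move=> xy aff; do 2 (case: ifP; first by lia).
- by rewrite map_inj_uniq ?iota_uniq// => x y [].
- move=> e /mapP[j]; rewrite mem_iota => ij ->; rewrite memE; lia.
- by apply/allP => e /mapP[j]; rewrite mem_iota => ij ->; rewrite /left_edge /=; lia.
Qed.

Lemma right_prob a j : (a + K.*2.*2.+1 < j <= n)%N ->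
  (P (box (right_box a j)) <=
   P (box (window_box a)) * (q ^+ (j - (a + K.*2 + K.+1)))%:E)%E.
Proof.
move=> aj.
(* The admissible sources run from [a + K.*2 + K.+1] to [j - 1]; there are [k.+1 + K] of them when
   [j = a + K.*2.*2.+2 + k]. *)
have := @box_prob_bad a (right_edge a j)
  [seq (i, j) | i <- iota (a + K.*2 + K.+1) (j - (a + K.*2 + K.+1))].
rewrite size_map size_iota; apply.
- move=> [x y]; rewrite memE /right_edge /window_box /segment_edge /cross_edge /=.
  by move=> xy aff; do 2 (case: ifP; first by lia).
- by rewrite map_inj_uniq ?iota_uniq// => x y [].
- move=> e /mapP[i]; rewrite mem_iota => ij ->; rewrite memE; lia.
- by apply/allP => e /mapP[i]; rewrite mem_iota => ij ->; rewrite /right_edge /=; lia.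
Qed.

(** Crude count: a constrained edge has both ends among the [K.*2.*2.+2] vertices of the window, and
    each constraint has probability at least the minimum. *)
Lemma window_prob a : (a + K.*2.*2.+1 < n)%N ->
  ((Num.min (f Ms) (f Gs) ^+ (K.*2.*2.+2 ^ 2))%:E <= P (box (window_box a)))%E.
Proof.
move=> an; rewrite box_prob; last exact: measurable_window_box.
set m := Num.min _ _.
have m0 : 0 <= m by rewrite le_min !f_ge0.
have m1 : m <= 1 by rewrite ge_min f_le1.
rewrite lee_fin.
pose inw e := (a <= e.1 < a + K.*2.*2.+2)%N && (a <= e.2 < a + K.*2.*2.+2)%N.
pose s := [seq (x, y) | x <- iota a K.*2.*2.+2, y <- iota a K.*2.*2.+2].
have -> : (K.*2.*2.+2 ^ 2 = size s)%N by rewrite size_allpairs size_iota mulnn.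
apply: le_trans (@prod_if_ge _ _ _ s inw m m0 m1 (fset_uniq E) _) _.
  move=> [x y] _ xy; apply/allpairsP; exists (x, y).
  by move: xy; rewrite /inw !mem_iota /= => /andP[? ?]; split=> //; lia.
apply: ler_prod => -[x y] _; apply/andP; split; first by case: ifP.
case: ifPn => xy; rewrite /window_box.
  by case: ifP => _; [|case: ifP => _]; rewrite ?f_setT// ge_min lexx ?orbT.
case: ifP; first by move: xy; rewrite /inw /segment_edge /=; lia.
by case: ifP; [move: xy; rewrite /inw /cross_edge /=; lia|rewrite f_setT].
Qed.

Definition window_event a : set T := box (window_box a) `\`
  ((\big[setU/set0]_(i < a) box (left_box a i)) `|`
   (\big[setU/set0]_(k < n - (a + K.*2.*2.+1)) box (right_box a (a + K.*2.*2.+2 + k)))).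

Lemma measurable_window_event a : measurable (window_event a).
Proof.
apply: measurableD; first by apply: measurable_box; exact: measurable_window_box.
apply: measurableU; apply: bigsetU_measurable => i _; apply: measurable_box.
  exact: measurable_left_box.
exact: measurable_right_box.
Qed.

Lemma window_eventP a w : window_event a w ->
  [/\ forall e, e \in E -> segment_edge a e -> Ms (V e w),
      forall e, e \in E -> cross_edge a e -> Gs (V e w),
      forall i, (i < a)%N -> exists j, (i < j <= minn n (a + K))%N /\ Ms (V (i, j) w)
    & forall j, (a + K.*2.*2.+1 < j <= n)%N ->
        exists i, (a + K.*2 + K.+1 <= i < j)%N /\ Ms (V (i, j) w)].
Proof.
move=> [wR /not_orP[wl wr]].
(* The only unit edge crossing the middle starts at [a + K.*2], which [segment_edge] excludes. *)
have disj e : segment_edge a e -> cross_edge a e = false.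
  by rewrite /segment_edge /cross_edge => /and3P[? /eqP-> ?]; lia.
split.
- by move=> e eE se; have := wR e eE; rewrite /= /window_box se.
- move=> e eE ce; have := wR e eE; rewrite /= /window_box ce.
  by case: ifP => // /disj; rewrite ce.
- move=> i ia; apply: contrapT => h; apply: wl.
  rewrite -(bigcup_mkord _ (fun i => box (left_box a i))); exists i => // -[x y] eE /=; rewrite /left_box.
  case: ifPn => [/andP[/= /eqP xi yK]|_]; last exact: wR.
  move=> MV; apply: h; exists y; rewrite -xi; split => //.
  by move: eE; rewrite /= memE; lia.
- move=> j aj; apply: contrapT => h; apply: wr.
  rewrite -(bigcup_mkord _ (fun k => box (right_box a (a + K.*2.*2.+2 + k)))).
  exists (j - (a + K.*2.*2.+2))%N; first by rewrite /=; lia.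
  have -> : (a + K.*2.*2.+2 + (j - (a + K.*2.*2.+2)) = j)%N by lia.
  move=> [x y] eE /=; rewrite /right_box.
  case: ifPn => [/andP[/= /eqP xi yK]|_]; last exact: wR.
  move=> MV; apply: h; exists x; rewrite -xi; split => //.
  by move: eE; rewrite /= memE; lia.
Qed.

(** Relative to the window box, the failures on each side have total probability at most a quarter,
    whatever [n] and [a]; at least half of the box survives. *)
Lemma window_event_prob a : (a + K.*2.*2.+1 < n)%N -> 0 < f Ms ->
  q ^+ K <= f Ms / 4 ->
  ((Num.min (f Ms) (f Gs) ^+ (K.*2.*2.+2 ^ 2) / 2)%:E <= P (window_event a))%E.
Proof.
move=> an p0 qK.
have q0 : 0 <= q by rewrite subr_ge0 f_le1.
have q1 : q <= 1 by rewrite gerBl.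
(* A geometric sum of ratio [q] is at most [1 / f Ms], and the factor [q ^+ K] is at most
   [f Ms / 4]. *)
have geo m : \sum_(i < m) q ^+ (i.+1 + K) <= 4^-1.
  under eq_bigr do rewrite exprD exprS.
  rewrite -mulr_suml -mulr_sumr.
  have : f Ms * \sum_(i < m) q ^+ i <= 1.
    have -> : f Ms * \sum_(i < m) q ^+ i = 1 - q ^+ m.
      by rewrite -[RHS]opprB subrX1; ring.
    by rewrite gerBl exprn_ge0.
  have S0 : 0 <= \sum_(i < m) q ^+ i by apply: sumr_ge0 => i _; rewrite exprn_ge0.
  have qK0 : 0 <= q ^+ K by rewrite exprn_ge0.
  move: q0 q1 qK S0 qK0; set S := \sum_(_ < _) _; set Q := q ^+ K.
  move=> q0 q1 qK S0 qK0 pS.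
  apply: (@le_trans _ _ (S * Q)); first by rewrite ler_wpM2r// ler_piMl.
  apply: (@le_trans _ _ (S * (f Ms / 4))); first by rewrite ler_wpM2l.
  by lra.
set p := f Ms in p0 qK q0 q1 geo *.
set B := box (window_box a).
have mB : measurable B by apply: measurable_box; exact: measurable_window_box.
have PBf : P B \is a fin_num by rewrite fin_num_measure.
pose Lf := \big[setU/set0]_(i < a) box (left_box a i).
pose Rt := \big[setU/set0]_(k < n - (a + K.*2.*2.+1)) box (right_box a (a + K.*2.*2.+2 + k)).
have mL : measurable Lf.
  by apply: bigsetU_measurable => i _; apply: measurable_box; exact: measurable_left_box.
have mR : measurable Rt.
  by apply: bigsetU_measurable => i _; apply: measurable_box; exact: measurable_right_box.
have PL : (P Lf <= P B * (4^-1)%:E)%E.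
  apply: le_trans (Boole_inequality P (A := fun i => box (left_box a i)) _) _.
    by move=> i _; apply: measurable_box; exact: measurable_left_box.
  apply: (@le_trans _ _ (\sum_(i < a) P B * (q ^+ (a - i + K))%:E)%E).
    by apply: lee_sum => i _; exact: left_prob.
  rewrite -ge0_sume_distrr; last by move=> i _; rewrite lee_fin exprn_ge0.
  rewrite sumEFin lee_wpmul2l// lee_fin.
  (* Numbering the vertices leftwards from the window turns [a - i] into [i.+1]. *)
  apply: le_trans (geo a); rewrite (reindex_inj rev_ord_inj) /=.
  by apply: ler_sum => i _; rewrite subKn.
have PR : (P Rt <= P B * (4^-1)%:E)%E.
  apply: le_trans (Boole_inequality P (A := fun k => box (right_box a (a + K.*2.*2.+2 + k))) _) _.
    by move=> i _; apply: measurable_box; exact: measurable_right_box.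
  apply: (@le_trans _ _ (\sum_(k < n - (a + K.*2.*2.+1)) P B * (q ^+ (k.+1 + K))%:E)%E).
    apply: lee_sum => i _; have := ltn_ord i => ilt.
    apply: le_trans (right_prob _) _; first by lia.
    by rewrite lee_wpmul2l// lee_fin; apply: ler_wiXn2l => //; lia.
  rewrite -ge0_sume_distrr; last by move=> i _; rewrite lee_fin exprn_ge0.
  by rewrite sumEFin lee_wpmul2l// lee_fin.
have PBW : (P B <= P (window_event a) + (P Lf + P Rt))%E.
  have mW := measurable_window_event a.
  apply: le_trans (leeD2l _ (measureU2 _ mL mR)).
  apply: le_trans (measureU2 _ mW (measurableU _ _ mL mR)).
  apply: le_measure; rewrite ?inE//; first by apply: measurableU => //; apply: measurableU.
  move=> w Bw; rewrite /window_event -/B -/Lf -/Rt.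
  by have [LRw|LRw] := EM ((Lf `|` Rt) w); [right|left].
have := window_prob an; rewrite -/B -/p.
have WF : P (window_event a) \is a fin_num.
  by rewrite fin_num_measure//; exact: measurable_window_event.
have := le_trans PBW (leeD2l _ (leeD PL PR)).
rewrite -(fineK PBf) -(fineK WF) -!EFinM -!EFinD !lee_fin.
by lra.
Qed.

End GoodProb.

(** * Expectations *)

Section Clamp.
Context {R : realType} (M : R).

Definition clamp (y : \bar R) : \bar R := mine (maxe y 0%E) M%:E.

Lemma clamp_continuous : continuous clamp.
Proof.
apply: min_fun_continuous; last exact: cst_continuous.
apply: max_fun_continuous; last exact: cst_continuous.
by move=> x; exact: cvg_id.
Qed.

Lemma measurable_clamp : measurable_fun setT clamp.
Proof.
apply: measurable_mine; last exact: measurable_cst.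
by apply: measurable_maxe; [exact: measurable_id|exact: measurable_cst].
Qed.

Hypothesis M0 : 0 <= M.

Lemma clamp_ge0 y : (0 <= clamp y)%E.
Proof. by rewrite le_min le_max lexx orbT lee_fin. Qed.

Lemma clamp_le y : (clamp y <= M%:E)%E.
Proof. by rewrite ge_min lexx orbT. Qed.

Lemma clamp_fin_num y : clamp y \is a fin_num.
Proof.
by rewrite ge0_fin_numE ?clamp_ge0// (le_lt_trans (clamp_le y))// ltry.
Qed.

Lemma le_clamp y z : (y <= z)%E -> (clamp y <= clamp z)%E.
Proof.
by move=> yz; apply: Order.TotalTheory.le_min2 => //; exact: Order.TotalTheory.le_max2.
Qed.

End Clamp.

Section Expectation.
Context {R : realType}.
Implicit Types nu : probability (\bar R) R.

(** Dominated convergence with the constant [M]. As [clamp] is continuous on the extended line, the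
    limit [C] may be infinite. *)
Lemma cvg_expectation (M : R) (d : measure_display) (T : measurableType d)
    (P : probability T R) (Y : nat -> T -> \bar R) (C : \bar R) : 0 <= M ->
  (forall n, measurable_fun setT (Y n)) ->
  {ae P, forall w, (fun n => Y n w) @ \oo --> C} ->
  (fun n => \int[P]_w clamp M (Y n w))%E @ \oo --> clamp M C.
Proof.
move=> M0 mY YC.
have mc := @measurable_clamp R M.
have [] := @dominated_convergence _ T R P setT measurableT
  (fun n w => clamp M (Y n w)) (cst (clamp M C)) (cst M%:E).
- by move=> n; apply: measurableT_comp.
- exact: measurable_cst.
- apply: filterS YC => w YwC _.
  apply: (cvg_comp _ _ YwC); exact: clamp_continuous.
- exact: finite_measure_integrable_cst.
- apply: aeW => w n _; rewrite gee0_abs ?clamp_ge0//; exact: clamp_le.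
move=> _ _; rewrite integral_cst// [X in (_ * X)%E]probability_setT mule1.
exact.
Qed.

(** * Expected gain under the quantile coupling *)

Lemma fset_edges n : exists E : {fset nat * nat},
  forall i j, ((i, j) \in E) = (i < j <= n)%N.
Proof.
exists [fset e in [seq (i, j) | i <- iota 0 n.+1, j <- iota 0 n.+1] | (e.1 < e.2)%N]%fset.
move=> i j; rewrite in_fset; apply/andP/idP => [[]|ij].
  case/allpairsP=> -[x y] []; rewrite !mem_iota => /= ? ? [-> ->] ?; lia.
split; last by rewrite /=; lia.
by apply/allpairsP; exists (i, j); rewrite !mem_iota; split => //=; lia.
Qed.

Lemma iid_weights_box nu (d : measure_display) (T : measurableType d)
    (P : probability T R) (X : nat -> nat -> T -> \bar R) (E : {fset nat * nat})
    (B : nat * nat -> set (\bar R)) :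
  iid_weights nu P X -> (forall e, e \in E -> (e.1 < e.2)%N) ->
  (forall e, measurable (B e)) ->
  P (\bigcap_(e in [set` E]) (X e.1 e.2 @^-1` B e)) = (\prod_(e <- E) nu (B e))%E.
Proof.
move=> [mX lX iX] E12 mB; rewrite iX//; apply: eq_big_seq => e eE.
by rewrite lX// E12.
Qed.

(** The bound of [window_event_prob] for uniform variables; it involves neither [n] nor the position
    of the window, which makes the gain linear in [n]. *)
Definition window_prob_bound (M t delta : R) K nu1 nu2 : R :=
  Num.min (fine (nu1 [set M%:E]))
    (fine (uniform_prob (@ltr01 R) [set u | (quantile M nu1 u <= t%:E)%E /\
       ((t + delta)%:E <= quantile M nu2 u)%E])) ^+ (K.*2.*2.+2 ^ 2) / 2.

Lemma expectation_gap (M t delta : R) (K n m : nat) nu1 nu2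
    (d1 d2 : measure_display) (T1 : measurableType d1) (T2 : measurableType d2)
    (P1 : probability T1 R) (P2 : probability T2 R)
    (X1 : nat -> nat -> T1 -> \bar R) (X2 : nat -> nat -> T2 -> \bar R) :
  0 < M -> 0 <= delta -> M - t <= K%:R * M ->
  nu1 [set x | (x <= M%:E)%E] = 1%E -> nu2 [set x | (x <= M%:E)%E] = 1%E ->
  (0 < nu1 [set M%:E])%E ->
  (1 - fine (nu1 [set M%:E])) ^+ K <= fine (nu1 [set M%:E]) / 4 ->
  stochastically_dominated nu1 nu2 ->
  iid_weights nu1 P1 X1 -> iid_weights nu2 P2 X2 ->
  (0 < n)%N -> (m * K.*2.*2.+2 <= n)%N ->
  (\int[P1]_w clamp M (last_passage (fun i j => X1 i j w) n * (n%:R^-1)%:E) +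
    (delta * n%:R^-1 * (m%:R * window_prob_bound M t delta K nu1 nu2))%:E <=
   \int[P2]_w clamp M (last_passage (fun i j => X2 i j w) n * (n%:R^-1)%:E))%E.
Proof.
move=> M0 delta0 Kt nuM1 nuM2 p0 qK dom iid1 iid2 n0 mn.
set c := window_prob_bound _ _ _ _ _ _.
have [E memE] := fset_edges n.
have E12 e : e \in E -> (e.1 < e.2)%N by case: e => i j; rewrite memE => /andP[].
pose U : probability (g_sigma_algebraType R.-ocitv.-measurable) R :=
  uniform_prob (@ltr01 R).
have [d [T [P [V [mV PV]]]]] := independent_family U (fset_uniq E).
have mq1 := measurable_quantile nuM1; have mq2 := measurable_quantile nuM2.
pose h y := clamp M (y * (n%:R^-1)%:E)%E.
have mh : measurable_fun setT h.
  apply: measurableT_comp; first exact: measurable_clamp.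
  by apply: emeasurable_funM; [exact: measurable_id|exact: measurable_cst].
have h0 y : (0 <= h y)%E by apply: clamp_ge0; exact: ltW.
(* The coupling: [Y nu1] and [Y nu2] read the same uniform variable on each edge. *)
pose Y nu (e : nat * nat) (w : T) := quantile M nu (V e w).
have mY nu e : measurable_fun setT (quantile M nu) -> measurable_fun setT (Y nu e).
  by move=> mq; apply: measurableT_comp.
have PY nu B : nu [set x | (x <= M%:E)%E] = 1%E -> (forall e, measurable (B e)) ->
    P (\bigcap_(e in [set` E]) (Y nu e @^-1` B e)) = (\prod_(e <- E) nu (B e))%E.
  move=> nuM mB; rewrite (PV (fun e => quantile M nu @^-1` B e)).
    by apply: eq_bigr => e _; exact: quantile_law.
  by move=> e; rewrite -[X in measurable X]setTI; exact: measurable_quantile.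
have law nu d' (T' : measurableType d') (P' : probability T' R) X' :
    nu [set x | (x <= M%:E)%E] = 1%E -> iid_weights nu P' X' ->
    (\int[P']_w h (last_passage (fun i j => X' i j w) n) =
     \int[P]_w h (last_passage (fun i j => Y nu (i, j) w) n))%E.
  move=> nuM iid'.
  apply: (@eq_law_last_passage _ _ _ _ _ _ _ (fun e => X' e.1 e.2) (Y nu) E n h) => //.
  - by move=> i j; rewrite memE.
  - by case: iid' => mX _ _ e /E12; exact: mX.
  - by move=> e _; apply: mY; exact: measurable_quantile.
  - by move=> B mB; rewrite PY// (iid_weights_box iid').
rewrite (law nu1 _ _ _ _ nuM1 iid1) (law nu2 _ _ _ _ nuM2 iid2).
pose Ms := quantile M nu1 @^-1` [set M%:E].
pose Gs := [set u | (quantile M nu1 u <= t%:E)%E /\ ((t + delta)%:E <= quantile M nu2 u)%E].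
have mMs : measurable Ms by rewrite -[X in measurable X]setTI; exact: mq1.
have UMs : U Ms = nu1 [set M%:E] by apply: quantile_law.
have mGs : measurable Gs.
  exact: measurable_quantile_gap.
pose L := K.*2.*2.+2.
pose Ev k := window_event Ms Gs K V E n (k * L).
have mEv k : measurable (Ev k) by exact: measurable_window_event.
have PEv k : (k < m)%N -> (c%:E <= P (Ev k))%E.
  move=> km; have := @window_event_prob _ _ _ U Ms Gs mMs mGs K _ T P V E n mV PV memE (k * L).
  rewrite UMs; apply => //.
  - by rewrite /L; nia.
  - by rewrite fine_gt0// p0 ltey_eq fin_num_measure.
have pt w : (h (last_passage (fun i j => Y nu1 (i, j) w) n) +
    \sum_(k < m) ((delta * n%:R^-1) * \1_(Ev k) w)%:E <=
    h (last_passage (fun i j => Y nu2 (i, j) w) n))%E.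
  have Y12 i j : (i < j)%N -> (Y nu1 (i, j) w <= Y nu2 (i, j) w <= M%:E)%E.
    by move=> _; rewrite le_quantile//= quantile_leM.
  have := last_passage_gain M0 delta0 Kt Y12 mn.
  set W1 := last_passage _ _; set W2 := last_passage _ _ => gain.
  have n1 : 0 < n%:R^-1 :> R by rewrite invr_gt0 ltr0n.
  have W2M : (maxe W2 0 <= (n%:R * M)%:E)%E.
    rewrite ge_max lee_fin mulr_ge0 ?ler0n ?(ltW M0)// andbT.
    by apply: last_passage_le (ltW M0) _ => i j /Y12/andP[].
  have hE W : h W = mine (maxe W 0 * (n%:R^-1)%:E)%E M%:E.
    by rewrite /h /clamp maxe_pMl ?lee_fin ?ltW// mul0e.
  (* The upper truncation is inactive for the larger family, so the gain is not cut off; for [W1] it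
     can only lower the value. *)
  have -> : h W2 = (maxe W2 0 * (n%:R^-1)%:E)%E.
    rewrite hE; apply/min_idPl.
    apply: le_trans (lee_wpmul2r _ W2M) _; first by rewrite lee_fin ltW.
    by rewrite -EFinM lee_fin mulrAC mulfV ?mul1r// gt_eqF// ltr0n.
  apply: (@le_trans _ _ ((maxe W1 0 + (delta * \sum_(k < m) \1_(Ev k) w)%:E) * (n%:R^-1)%:E)%E); last first.
    rewrite lee_wpmul2r ?lee_fin ?(ltW n1)//.
    apply: le_trans gain; rewrite leeD2l// lee_fin ler_wpM2l//.
    apply: ler_sum => k _; rewrite indicE.
    case: asboolP => [_|ngood]; first by case: (_ \in _).
    rewrite (_ : w \in Ev k = false)//; apply/negbTE; rewrite notin_setE => Evk.
    apply: ngood; have [hs hc hl hr] := window_eventP memE Evk.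
    have kn : ((k * L) + L <= n)%N by have := ltn_ord k; rewrite /L; nia.
    split.
    - move=> i /hl[j [ij Mj]]; exists j; split; first by lia.
      by rewrite /Y Mj.
    - move=> j /hr[i [ij Mj]]; exists i; split; first by lia.
      by rewrite /Y Mj.
    - move=> i ia ic; have -> // : Y nu1 (i, i.+1) w = M%:E.
      apply: hs; first by rewrite memE; rewrite /L in ia kn; lia.
      by rewrite /segment_edge /= ia ic eqxx.
    - move=> i j iw jw; apply: (hc (i, j)).
        by rewrite memE; rewrite /L in iw jw kn *; lia.
      by rewrite /cross_edge /= iw jw.
  rewrite ge0_muleDl; last 2 first.
  - by rewrite le_max lexx orbT.
  - by rewrite lee_fin mulr_ge0// sumr_ge0// => k _; rewrite indicE.
  rewrite leeD//; first by rewrite hE ge_min lexx.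
  rewrite sumEFin -EFinM lee_fin -mulr_sumr mulrAC.
  exact: lexx.
have mW nu : nu [set x | (x <= M%:E)%E] = 1%E ->
    measurable_fun setT (fun w => h (last_passage (fun i j => Y nu (i, j) w) n)).
  move=> nuM; apply: measurableT_comp mh _.
  apply: measurable_last_passage => i j _; apply: mY; exact: measurable_quantile.
have mI k : measurable_fun setT (fun w => ((delta * n%:R^-1) * \1_(Ev k) w)%:E).
  apply/measurable_EFinP; apply: measurable_funM; first exact: measurable_cst.
  exact: measurable_indic.
have dn0 : 0 <= delta * n%:R^-1 by rewrite mulr_ge0// invr_ge0.
have I0 k w : (0 <= ((delta * n%:R^-1) * \1_(Ev k) w)%:E)%E.
  by rewrite lee_fin mulr_ge0// indicE.
apply: le_trans (ge0_le_integral P measurableT _ _ _ (fun w _ => pt w)); last 3 first.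
- by move=> w _; rewrite adde_ge0// sume_ge0.
- by apply: emeasurable_funD; [exact: mW|apply: emeasurable_sum].
- exact: mW.
rewrite ge0_integralD//; last 3 first.
- exact: mW.
- by move=> w _; rewrite sume_ge0.
- by apply: emeasurable_sum.
rewrite leeD2l// ge0_integral_sum//.
apply: (@le_trans _ _ (\sum_(k < m) ((delta * n%:R^-1) * c)%:E)%E).
  by rewrite sumEFin sumr_const card_ord lee_fin -[leRHS]mulr_natl mulrCA.
apply: lee_sum => k _; under eq_integral do rewrite EFinM.
rewrite ge0_integralZl//; last first.
- by apply/measurable_EFinP; exact: measurable_indic.
rewrite integral_indic// setIT EFinM lee_wpmul2l//.
exact: PEv.
Qed.

End Expectation.

(** * Choice of the window size and passage to the limit *)

Lemma window_size_exists (R : realType) (M t p : R) : 0 < M -> 0 < p -> p <= 1 ->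
  exists K : nat, M - t <= K%:R * M /\ (1 - p) ^+ K <= p / 4.
Proof.
move=> M0 p0 p1.
have [K1 K1E] : exists K, (1 - p) ^+ K < p / 4.
  have q1 : `|1 - p| < 1 by rewrite ger0_norm; lra.
  have p4 : 0 < p / 4 by lra.
  have [N _ HN] := (cvgr0Pnorm_lt _).1 (cvg_expr q1) _ p4.
  exists N; have := HN N (leqnn N); rewrite /= ger0_norm// exprn_ge0//; lra.
pose K2 := Num.bound `|(M - t) / M|.
(* Both conditions persist when [K] grows: [K1] serves the geometric one and [K2] the Archimedean
   one. *)
exists (K1 + K2)%N; split.
  have : (M - t) / M < K2%:R.
    by apply: le_lt_trans (ler_norm _) _; exact: archi_boundP.
  rewrite ltr_pdivrMr// => /ltW/le_trans; apply.
  by rewrite ler_pM2r// ler_nat leq_addl.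
apply: le_trans (ltW K1E); apply: ler_wiXn2l; rewrite ?leq_addr//; lra.
Qed.

Theorem theorem1p1 (R : realType) (M : R) (hM : 0 < M)
    (nu1 nu2 : probability (\bar R) R)
    (nu1_le_M : nu1 [set x | (x <= M%:E)%E] = 1%E)
    (nu1_atom : (0 < nu1 [set M%:E])%E)
    (nu2_le_M : nu2 [set x | (x <= M%:E)%E] = 1%E)
    (nu2_atom : (0 < nu2 [set M%:E])%E)
    (nu12_neq : ~ same_distribution nu1 nu2)
    (nu12_dom : stochastically_dominated nu1 nu2)
    (C1 C2 : \bar R)
    (hC1 : is_time_constant nu1 C1)
    (hC2 : is_time_constant nu2 C2) :
  (C1 < C2)%E.
Proof.
have [d1 [T1 [P1 [X1 [iid1 lim1]]]]] := hC1.
have [d2 [T2 [P2 [X2 [iid2 lim2]]]]] := hC2.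
have [t [delta [delta0 gap]]] := dominated_gap nu12_neq nu12_dom.
have gap_gt0 := quantile_gap nu1_le_M nu2_le_M (ltW delta0) gap.
have mgap := measurable_quantile_gap t (t + delta) nu1_le_M nu2_le_M.
pose p := fine (nu1 [set M%:E]).
have nu1_fin : nu1 [set M%:E] \is a fin_num by rewrite fin_num_measure.
have p0 : 0 < p by rewrite fine_gt0// nu1_atom ltey_eq nu1_fin.
have p1 : p <= 1 by rewrite -lee_fin fineK// probability_le1.
have [K [Kt qK]] := window_size_exists t hM p0 p1.
pose c := window_prob_bound M t delta K nu1 nu2.
have c0 : 0 < c.
  rewrite divr_gt0// exprn_gt0// lt_min p0 fine_gt0// gap_gt0 /=.
  by rewrite ltey_eq fin_num_measure.
pose L := K.*2.*2.+2.
(* At least [n / (2 * L)] windows fit below [n] once [L <= n]; each is good with probability at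
   least [c] and then adds [delta / n]. *)
pose kappa := delta * c / (2 * L%:R).
have LR : 0 < L%:R :> R by rewrite ltr0n.
have kappa0 : 0 < kappa by apply: divr_gt0; apply: mulr_gt0.
have mW (nu : probability (\bar R) R) d (T : measurableType d) (P : probability T R) X n :
    iid_weights nu P X ->
    measurable_fun setT (fun w => last_passage (fun i j => X i j w) n * (n%:R^-1)%:E)%E.
  move=> [mX _ _]; apply: emeasurable_funM; last exact: measurable_cst.
  by apply: measurable_last_passage => i j /andP[ij _]; exact: mX.
have cvg1 := cvg_expectation (ltW hM) (fun n => mW _ _ _ _ _ n iid1) lim1.
have cvg2 := cvg_expectation (ltW hM) (fun n => mW _ _ _ _ _ n iid2) lim2.
have clampD : (clamp M C1 + kappa%:E <= clamp M C2)%E.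
  have C1_def : (clamp M C1 +? kappa%:E)%E by exact: fin_num_adde_defl.
  have cvg1D := cvgeD C1_def cvg1 (cvg_cst kappa%:E).
  apply: (lee_cvg_to (cvg1D _ _) cvg2).
  exists L => // n /= Ln.
  have L0 : (0 < L)%N by [].
  have n0 : (0 < n)%N by apply: leq_trans Ln.
  have mn : (n %/ L * L <= n)%N by exact: leq_trunc_div.
  apply: le_trans (expectation_gap hM (ltW delta0) Kt nu1_le_M nu2_le_M
    nu1_atom qK nu12_dom iid1 iid2 n0 mn).
  rewrite leeD2l// lee_fin -/c /kappa.
  (* The remainder is less than [L], itself at most [n %/ L * L] since [L <= n]. *)
  have nm : (n <= 2 * (n %/ L * L))%N.
    rewrite {1}(divn_eq n L) mul2n -addnn leq_add2l.
    by rewrite (leq_trans (ltnW (ltn_pmod n L0)))// leq_pmull// divn_gt0.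
  have nR : 0 < n%:R :> R by rewrite ltr0n.
  have -> : delta / n%:R * ((n %/ L)%:R * c) = (delta * c) * ((n %/ L)%:R / n%:R).
    by ring.
  apply: ler_wpM2l; first by rewrite mulr_ge0// ltW.
  rewrite ler_pdivlMr// mulrC ler_pdivrMr ?mulr_gt0//.
  by rewrite -!natrM ler_nat mulnCA.
(* Truncated values are finite, so adding [kappa] strictly increases them; [C2 <= C1] would
   contradict this by monotonicity of [clamp]. *)
rewrite ltNge; apply/negP => /(le_clamp M) C21.
have := le_trans clampD C21.
by rewrite leNgt lteDl ?clamp_fin_num ?lte_fin ?kappa0// ltW.
Qed.
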